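(* For all integers $n,k \geq 1$ with $1 \leq k \leq n$, $$s_{n,k}^{(-1)} = \sum_{d\mid n} p(d-k)\, \mu(n/d),$$ where the sum runs over the positive divisors $d$ of $n$.
   Context: For integers $i,j\ge 1$ let $s_{i,j} := s_o(i,j)-s_e(i,j)$, where $s_o(i,j)$ (respectively $s_e(i,j)$) is the number of $j$'s appearing in all partitions of $i$ into an odd (respectively even) number of distinct parts. Equivalently, $s_{i,j} = [q^i]\, \frac{q^j}{1-q^j}\,(q;q)_\infty$, where $(q;q)_\infty=\prod_{m\ge1}(1-q^m)$ and $[q^i]$ denotes the coefficient of $q^i$. For $N\ge1$ let $A_N := (s_{i,j})_{1\le i,j\le N}$; this matrix is lower triangular with ones on its diagonal, hence invertible. Let $s_{i,j}^{(-1)}$ denote the $(i,j)$ entry of $A_N^{-1}$, for any $N\ge\max(i,j)$; it does not depend on the choice of such $N$. $p$ denotes Euler's partition function: $p(n)=[q^n]\,(q;q)_\infty^{-1}$ is the number of partitions of $n$ for $n\ge0$ (so $p(0)=1$), and $p(n)=0$ for $n<0$. $\mu$ denotes the Möbius function. *)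

(* Defs.v *)
From mathcomp Require Import all_boot all_order all_algebra.
Set Implicit Arguments.
Unset Strict Implicit.
Unset Printing Implicit Defensive.
Import GRing.Theory.

(* A partition of n is encoded by its multiplicities: f a is the number of    *)
(* parts equal to a.+1 (parts and multiplicities of a partition of n are <= n *)
(* so that the ambient type is finite; n = 0 yields the empty partition).     *)
Definition multiplicities (n : nat) := {ffun 'I_n -> 'I_n.+1}.

Definition is_partition (n : nat) (f : multiplicities n) : bool :=
  (\sum_(a < n) a.+1 * f a == n)%N.

Definition nb_parts (n : nat) (f : multiplicities n) : nat := \sum_(a < n) f a.

Definition distinct_parts (n : nat) (f : multiplicities n) : bool :=
  [forall a, f a <= 1].

(* No index matches when j = 0 or j > n. *)
Definition occurrences (n : nat) (f : multiplicities n) (j : nat) : nat :=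
  \sum_(a < n | a.+1 == j) f a.

Definition s_odd (i j : nat) : nat :=
  \sum_(f : multiplicities i |
        [&& is_partition f, distinct_parts f & odd (nb_parts f)])
     occurrences f j.

Definition s_even (i j : nat) : nat :=
  \sum_(f : multiplicities i |
        [&& is_partition f, distinct_parts f & ~~ odd (nb_parts f)])
     occurrences f j.

Definition s (i j : nat) : int := ((s_odd i j)%:Z - (s_even i j)%:Z)%R.

(* Ordinals start at 0, so row i and column j hold s_{i+1,j+1}. *)
Definition smx (N : nat) : 'M[int]_N := (\matrix_(i, j) s i.+1 j.+1)%R.

Definition nb_partitions (n : nat) : nat :=
  #|[pred f : multiplicities n | is_partition f]|.

Definition partition_fun (m : int) : int :=
  match m with Posz n => (nb_partitions n)%:Z | Negz _ => 0%R end.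

(* Only meaningful for n > 0, as [primes 0] is empty. *)
Definition moebius (n : nat) : int :=
  if all (fun p => logn p n == 1%N) (primes n) then ((-1) ^+ size (primes n))%R
  else 0%R.

Lemma occurrencesS n (f : multiplicities n) (a : 'I_n) :
  occurrences f a.+1 = f a.
Proof. by rewrite /occurrences (big_pred1 a). Qed.

Lemma occurrences_gt n (f : multiplicities n) j : n < j -> occurrences f j = 0.
Proof.
move=> lt_nj; rewrite /occurrences big_pred0 // => a.
by rewrite ltn_eqF // (leq_ltn_trans (ltn_ord a)).
Qed.

Lemma s_gt i j : i < j -> s i j = 0%R.
Proof.
move=> lt_ij; by rewrite /s /s_odd /s_even !big1 ?subrr // => f _; rewrite occurrences_gt.
Qed.

(* The partition of n.+1 into a single part. *)
Definition one_part n : multiplicities n.+1 :=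
  [ffun a => inord (a == ord_max)].

Lemma one_partE n a : one_part n a = (a == ord_max) :> nat.
Proof. by rewrite ffunE inordK //; case: eqP. Qed.

Lemma occurrences_max n (f : multiplicities n.+1) :
  is_partition f -> occurrences f n.+1 != 0 -> f = one_part n.
Proof.
rewrite (occurrencesS f ord_max) => /eqP pf f0; rewrite -lt0n in f0.
have := pf; rewrite (bigD1 ord_max) //= => sf.
have f1 : f ord_max = 1 :> nat.
  apply/eqP; rewrite eqn_leq f0 andbT -(leq_pmul2l (ltn0Sn n)) muln1.
  exact: leq_trans (leq_addr _ _) (eq_leq sf).
move: sf; rewrite f1 muln1 => /eqP; rewrite -[X in _ == X]addn0 eqn_add2l.
rewrite sum_nat_eq0 => /forallP fa0; apply/ffunP=> a; apply/val_inj.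
rewrite /= one_partE; case: eqVneq => [-> //|ane].
by have := fa0 a; rewrite ane /= muln_eq0 /= => /eqP.
Qed.

Lemma one_partP n : [&& is_partition (one_part n), distinct_parts (one_part n)
                      & nb_parts (one_part n) == 1].
Proof.
apply/and3P; split.
- rewrite /is_partition (bigD1 ord_max) //= big1 ?one_partE ?eqxx ?muln1 ?addn0//.
  by move=> a /negbTE ane; rewrite one_partE ane muln0.
- by apply/forallP=> a; rewrite one_partE; case: eqP.
- rewrite /nb_parts (bigD1 ord_max) //= big1 ?one_partE ?eqxx //.
  by move=> a /negbTE ane; rewrite one_partE ane.
Qed.

Lemma s_diag n : s n.+1 n.+1 = 1%R.
Proof.
have /and3P[p1 d1 /eqP n1] := one_partP n.
have o1 : occurrences (one_part n) n.+1 = 1.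
  by rewrite (occurrencesS _ ord_max) one_partE eqxx.
rewrite /s /s_odd /s_even (bigD1 (one_part n)) /=; last by rewrite p1 d1 n1.
rewrite o1 !big1 // => f.
- case/and3P=> pf df; apply: contraNeq => /(occurrences_max pf) ->.
  by rewrite n1.
- case/andP=> /and3P[pf _ _]; apply: contraNeq => /(occurrences_max pf) ->.
  by [].
Qed.

Lemma smx_unit N : smx N \in unitmx.
Proof.
rewrite unitmxE det_trig; last first.
  by apply/is_trig_mxP => i j lt_ij; rewrite mxE s_gt.
by rewrite big1 ?unitr1 // => i _; rewrite mxE s_diag.
Qed.

(* Main.v *)
Require Import Defs.
From mathcomp Require Import all_boot all_order all_algebra.
Local Open Scope ring_scope.

Set Implicit Arguments.
Unset Strict Implicit.
Unset Printing Implicit Defensive.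
Import GRing.Theory.

(** Column [j] of the matrix has generating function
[(q;q)_oo * (q^j + q^(2j) + ...)]: removing the factor [1 - q^j] from the Euler
product and putting [q^j] in its place makes [j] a compulsory part. Hence the
matrix is a product [E D], where [E] is the Toeplitz matrix of the coefficients
of [(q;q)_oo] and [D] is the divisibility matrix, with entry 1 at [(l, j)] when
[j] divides [l] ([smx_factor]). Each factor has a known inverse. The generating
function of the partition numbers is the inverse series of [(q;q)_oo]
([euler_invP], [nb_partitions_coef]), so [E^-1] is the Toeplitz matrix with
entries [p(d - k)]; Moebius inversion says that [D^-1] has entries [mu(n/d)] at
the pairs where [d] divides [n] ([dirichlet_moebiusK]). The claimed formula is
the entry of the product [D^-1 E^-1].

As matrices have a finite size [N], power series are replaced by integer
polynomials considered modulo [X^N]. Rows and columns are numbered from 0, which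
divides all the generating functions of columns by [X]. *)

(** * Moebius inversion *)

(** The recursion that pairs off divisors with opposite signs: multiplying by a
prime either creates a square factor or adds one new prime. *)
Lemma moebius_mul_prime p d : prime p -> (0 < d)%N ->
  moebius (p * d)%N = if (p %| d)%N then 0 else - moebius d.
Proof.
move=> p_pr d_gt0; have p_gt0 := prime_gt0 p_pr.
have primes_pd q : (q \in primes (p * d)%N) = (q == p) || (q \in primes d).
  by rewrite primesM // primes_prime // inE.
have p_in_pd : p \in primes (p * d)%N by rewrite primes_pd eqxx.
have p_in_d : (p \in primes d) = (p %| d)%N by rewrite mem_primes p_pr d_gt0.
case: ifP => [dv_pd | ndv_pd].
  rewrite /moebius; case: ifP => // /allP/(_ p p_in_pd).
  rewrite lognM // lognE p_pr p_gt0 dvdnn divnn p_gt0 logn1.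
  by rewrite lognE p_pr d_gt0 dv_pd.
have perm_pd : perm_eq (primes (p * d)%N) (p :: primes d).
  apply: uniq_perm => [||q]; rewrite /= ?primes_uniq ?p_in_d ?ndv_pd //.
rewrite /moebius (perm_size perm_pd) (perm_all _ perm_pd) /=.
rewrite lognM // (logn_prime _ p_pr) eqxx lognE p_pr d_gt0 ndv_pd /=.
rewrite (eq_in_all (a2 := fun q => logn q d == 1%N)) => [|q q_in].
  by case: ifP; rewrite ?oppr0 // exprS mulN1r.
rewrite lognM // (logn_prime _ p_pr); case: (eqVneq q p) q_in => // ->.
by rewrite p_in_d ndv_pd.
Qed.

(** With [p] a prime divisor of [n = p m], the divisors of [n] prime to [p] are
those of [m] prime to [p], and the other ones are the [p d] with [d] a divisor of [m]; by
[moebius_mul_prime] the contribution of [p d] cancels that of [d] when [p] does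
not divide [d], and is null otherwise. *)
Lemma sum_moebius n : (0 < n)%N ->
  \sum_(d <- divisors n) moebius d = (n == 1%N)%:R.
Proof.
move=> n_gt0; have [->|n_neq1] := eqVneq n 1%N; first by rewrite big_seq1.
have p_pr : prime (pdiv n) by rewrite pdiv_prime // ltn_neqAle eq_sym n_neq1.
have p_gt0 := prime_gt0 p_pr; move: (pdiv n) (pdiv_dvd n) p_pr p_gt0 => p.
case/dvdnP=> m defn p_pr p_gt0; subst n; rewrite mulnC in n_gt0 n_neq1 *.
have m_gt0 : (0 < m)%N by move: n_gt0; rewrite muln_gt0 => /andP[].
have split_div : perm_eq (divisors (p * m)%N)
    ([seq d <- divisors m | ~~ (p %| d)%N] ++ [seq (p * d)%N | d <- divisors m]).
  apply: uniq_perm => [||d]; first exact: divisors_uniq.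
    rewrite cat_uniq filter_uniq ?divisors_uniq //= map_inj_uniq ?divisors_uniq.
      rewrite andbT; apply/hasPn => _ /mapP[d _ ->].
      by rewrite mem_filter dvdn_mulr.
    by move=> d1 d2 /eqP; rewrite eqn_pmul2l // => /eqP.
  rewrite mem_cat mem_filter -!dvdn_divisors //.
  case dv_pd: (p %| d)%N => /=.
    case/dvdnP: dv_pd => e ->; rewrite mulnC dvdn_pmul2l //.
    rewrite mem_map -?dvdn_divisors //.
    by move=> d1 d2 /eqP; rewrite eqn_pmul2l // => /eqP.
  rewrite Gauss_dvdr; last by rewrite coprime_sym prime_coprime // dv_pd.
  apply/esym/orb_idr => /mapP[e _ eqd].
  by move: dv_pd; rewrite eqd dvdn_mulr.
rewrite (perm_big _ split_div) big_cat big_map big_filter /=.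
rewrite (big_mkcond (fun d => ~~ _)) -big_split big_seq /= big1 // => d.
rewrite -dvdn_divisors // => /(dvdn_gt0 m_gt0) d_gt0.
by rewrite moebius_mul_prime //; case: (p %| d)%N; rewrite /= ?addr0 ?subrr.
Qed.

Lemma big_divisors_ord (n N : nat) (F : nat -> int) : (0 < n <= N)%N ->
  \sum_(d <- divisors n) F d = \sum_(l < N | (l.+1 %| n)%N) F l.+1.
Proof.
case/andP=> n_gt0 le_nN.
rewrite -(big_mkord (fun l => l.+1 %| n)%N (fun l => F l.+1)).
rewrite -(big_add1 _ _ 0 N.+1 (fun d => d %| n)%N F) -big_filter.
apply: perm_big; apply: uniq_perm => [||d].
- exact: divisors_uniq.
- by rewrite filter_uniq ?iota_uniq.
rewrite mem_filter mem_index_iota -dvdn_divisors //.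
case dv_dn: (d %| n)%N => //=; rewrite (dvdn_gt0 n_gt0 dv_dn) ltnS.
by rewrite (leq_trans (dvdn_leq n_gt0 dv_dn)).
Qed.

(** Reindexing by [e = n / d] turns the divisors of [n] that are multiples of [j]
into the divisors of [n / j]. *)
Lemma sum_moebius_interval n j : (0 < n)%N ->
  \sum_(d <- divisors n | (j %| d)%N) moebius (n %/ d)%N = (n == j)%:R.
Proof.
move=> n_gt0; case dv_jn: (j %| n)%N; last first.
  rewrite big_seq_cond big_pred0 => [|d]; last first.
    rewrite -dvdn_divisors //; apply: contraFF dv_jn => /andP[dv_dn dv_jd].
    exact: dvdn_trans dv_jd dv_dn.
  by case: eqP dv_jn => // ->; rewrite dvdnn.
case/dvdnP: dv_jn n_gt0 => t -> {n}; rewrite muln_gt0 => /andP[t_gt0 j_gt0].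
have -> : (t * j == j)%N = (t == 1)%N by rewrite -{2}(mul1n j) eqn_pmul2r.
rewrite -(sum_moebius t_gt0) -big_filter.
have div_inj : {in divisors t &, injective (fun e => t * j %/ e)%N}.
  move=> d e; rewrite -!dvdn_divisors // => dv_d dv_e eq_de.
  have [d_gt0 e_gt0] := (dvdn_gt0 t_gt0 dv_d, dvdn_gt0 t_gt0 dv_e).
  have q_gt0 : (0 < t * j %/ d)%N.
    by rewrite divn_gt0 // dvdn_leq ?muln_gt0 ?t_gt0 // dvdn_mulr.
  apply/eqP; rewrite -(eqn_pmul2l q_gt0) divnK ?dvdn_mulr //.
  by rewrite eq_de divnK ?dvdn_mulr.
rewrite (perm_big [seq (t * j %/ e)%N | e <- divisors t]).
  rewrite big_map big_seq [RHS]big_seq; apply: eq_bigr => e.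
  rewrite -dvdn_divisors // => dv_e; congr moebius.
  have e_gt0 := dvdn_gt0 t_gt0 dv_e; have := dvdn_mulr j dv_e.
  case/dvdnP=> q tjE; rewrite tjE mulnK //.
  by rewrite mulKn // -(ltn_pmul2r e_gt0) -tjE muln_gt0 t_gt0.
apply: uniq_perm.
- by rewrite filter_uniq ?divisors_uniq.
- by rewrite map_inj_in_uniq ?divisors_uniq.
move=> d; rewrite mem_filter -dvdn_divisors ?muln_gt0 ?t_gt0 //.
apply/andP/mapP => [[/dvdnP[u ->]] | [e]].
  rewrite dvdn_pmul2r // => dv_u; have u_gt0 := dvdn_gt0 t_gt0 dv_u.
  exists (t %/ u)%N; first by rewrite -dvdn_divisors // dvdn_div.
  case/dvdnP: dv_u t_gt0 => q ->; rewrite muln_gt0 mulnK // => /andP[q_gt0 _].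
  by rewrite -mulnA mulKn.
rewrite -dvdn_divisors // => dv_e ->; split.
  by rewrite -divn_mulAC // dvdn_mull.
by rewrite dvdn_div // dvdn_mulr.
Qed.

(** * Power series modulo a power of X *)

Definition eqX (n : nat) (p q : {poly int}) : Prop :=
  forall i, (i < n)%N -> p`_i = q`_i.

Lemma eqX_refl n p : eqX n p p. Proof. by []. Qed.

Lemma eqX_sym n p q : eqX n p q -> eqX n q p.
Proof. by move=> epq i /epq. Qed.

Lemma eqX_trans n q p r : eqX n p q -> eqX n q r -> eqX n p r.
Proof. by move=> epq eqr i lt_in; rewrite epq ?eqr. Qed.

Lemma eqXM n p p' q q' : eqX n p p' -> eqX n q q' -> eqX n (p * q) (p' * q').
Proof.
move=> ep eq i lt_in; rewrite !coefM; apply: eq_bigr => a _.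
by rewrite ep ?eq // (leq_ltn_trans _ lt_in) ?leq_subr // -ltnS.
Qed.

Lemma eqX_1subXn n m : (n <= m)%N -> eqX n (1 - 'X^m) 1.
Proof.
by move=> le_nm i lt_in; rewrite coefB coefXn (ltn_eqF (leq_trans lt_in le_nm)) subr0.
Qed.

(** A left and a right inverse of the same truncated series agree. This compares
truncations of the partition generating function made at different orders,
without looking at their coefficients. *)
Lemma eqX_inv_uniq n p q r : eqX n (q * p) 1 -> eqX n (p * r) 1 -> eqX n q r.
Proof.
move=> qp pr; rewrite -[q]mulr1 -[r]mul1r.
apply: (eqX_trans (eqXM (eqX_refl q) (eqX_sym pr))).
by rewrite mulrA; apply: eqXM.
Qed.

Lemma eqX_prod1 n (I : Type) (r : seq I) (P : pred I) (F : I -> {poly int}) :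
  (forall i, P i -> eqX n (F i) 1) -> eqX n (\prod_(i <- r | P i) F i) 1.
Proof.
move=> F1; apply: (big_ind (eqX n ^~ 1)) => // p q ep eq.
by rewrite -[1]mulr1; apply: eqXM.
Qed.

(** * Generating functions of partitions *)

Definition euler (N : nat) : {poly int} := \prod_(a < N) (1 - 'X^(a.+1)).

(** Both the part sizes and the multiplicities are cut off at [N], which loses
nothing below [X^(N+1)]. *)
Definition euler_inv (N : nat) : {poly int} :=
  \prod_(a < N) \sum_(c < N.+1) 'X^(a.+1 * c).

(** The additional factors [1 - X^m], with [m > n], are 1 at this precision. *)
Lemma eqX_euler_widen (P : pred nat) n N : (n <= N)%N ->
  eqX n.+1 (\prod_(a < N | P a) (1 - 'X^(a.+1))) (\prod_(a < n | P a) (1 - 'X^(a.+1))).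
Proof.
move=> le_nN; rewrite -!(big_mkord P (fun a => 1 - 'X^(a.+1))).
rewrite (big_cat_nat _ le_nN) //= -[X in eqX _ _ X]mulr1.
apply: eqXM => //; rewrite big_nat_cond; apply: eqX_prod1 => a.
by case/andP=> /andP[le_na _] _; apply: eqX_1subXn.
Qed.

(** Each geometric sum times the matching factor telescopes to [1 - X^m] for a
multiple [m > N] of the part size. *)
Lemma euler_invP N : eqX N.+1 (euler_inv N * euler N) 1.
Proof.
rewrite -big_split; apply: eqX_prod1 => a _ /=.
rewrite mulrC (eq_bigr (fun c : 'I_N.+1 => ('X^(a.+1) : {poly int}) ^+ c)) => [|c _]; last first.
  by rewrite exprM.
have := subrX1 ('X^(a.+1) : {poly int}) N.+1; move/(congr1 -%R).
rewrite -mulNr !opprB => <-; rewrite -exprM; apply: eqX_1subXn.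
by rewrite leq_pmull.
Qed.

(** Expanding the product chooses one multiplicity for each part size, so that
multiplicative weights on partitions are coefficients of products. It is applied
below to the trivial weight, and to the signed weight that defines [s]. *)
Lemma big_partitions n (w : 'I_n -> nat -> int) :
  \sum_(f : multiplicities n | is_partition f) \prod_a w a (f a) =
  (\prod_a \sum_(c < n.+1) w a c *: 'X^(a.+1 * c))`_n.
Proof.
rewrite bigA_distr_bigA coef_sum big_mkcond /=; apply: eq_bigr => f _.
rewrite scaler_prod -(big_morph _ (exprD 'X) (expr0 'X)) coefZ coefXn.
by rewrite /is_partition eq_sym; case: ifP; rewrite ?mulr1 ?mulr0.
Qed.

(** The encoding of partitions of [n] gives a product whose length depends on
[n]; uniqueness of inverses makes a single [N] serve for all [n <= N]. *)
Lemma nb_partitions_coef n N : (n <= N)%N ->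
  (nb_partitions n)%:Z = (euler_inv N)`_n.
Proof.
move=> le_nN; transitivity ((euler_inv n)`_n).
  rewrite -natz /nb_partitions -sum1_card natr_sum.
  transitivity (\sum_(f : multiplicities n | is_partition f) \prod_(a < n) (1 : int)).
    by apply: eq_big => f; rewrite ?big1.
  rewrite (big_partitions (fun _ _ => 1)); congr (polyseq _)`_n.
  apply: eq_bigr => a _; apply: eq_bigr => c _; exact: scale1r.
suff: eqX n.+1 (euler_inv n) (euler_inv N) by apply.
apply: (@eqX_inv_uniq _ (euler N)).
  apply: eqX_trans (@euler_invP n).
  apply: eqXM => //.
  exact: (eqX_euler_widen xpredT).
rewrite mulrC => i le_in; apply: euler_invP.
exact: (leq_trans le_in).
Qed.

(** On partitions into distinct parts, the summand of [s] is multiplicative: the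
multiplicity [f b] is 0 or 1, so it selects the partitions where the part [b+1]
occurs, and the sign convention (odd minus even) is cancelled by the sign that
this part would contribute. *)
Lemma s_coef n (b : 'I_n) :
  s n b.+1 = ('X^(b.+1) * \prod_(a < n | a != b) (1 - 'X^(a.+1)))`_n.
Proof.
(* The factor at [b] is the multiplicity, the other ones are signs, and a
   repeated part kills the product. *)
pose w (a : 'I_n) (c : nat) : int :=
  if (c <= 1)%N then if a == b then c%:R else (-1) ^+ c else 0.
transitivity (\sum_(f : multiplicities n | is_partition f) \prod_a w a (f a)).
  rewrite /s /s_odd /s_even -!natz !natr_sum !(big_mkcond (fun f => _ && _)).
  rewrite -sumrB [RHS]big_mkcond; apply: eq_bigr => f _.
  case: (is_partition f) => /=; last exact: subr0.
  rewrite (occurrencesS f b).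
  case: (boolP (distinct_parts f)) => [/forallP f_le1 | ] /=; last first.
    rewrite negb_forall => /existsP[a /negbTE f_gt1]; rewrite subr0.
    by rewrite (bigD1 a) //= /w f_gt1 mul0r.
  rewrite /nb_parts (bigD1 b) //= (bigD1 (P := xpredT) b) //= {1}/w eqxx f_le1.
  under [X in _ * X]eq_bigr => a /negbTE ane do rewrite /w ane f_le1.
  rewrite -(big_morph _ (exprD (-1)) (expr0 (-1))).
  move: (\sum_(a < n | a != b) _)%N => m.
  case: (f b : nat) (f_le1 b) => [|[|]] //= _; first by rewrite mul0r !if_same subr0.
  by rewrite mul1r -signr_odd; case: (odd m).
have sum_w a : \sum_(c < n.+1) w a c *: 'X^(a.+1 * c) =
    (w a 0)%:P + w a 1%N *: 'X^(a.+1).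
  case: n b a @w => [[]//|n] b a w; rewrite 2!big_ord_recl big1 => [|c _].
    by rewrite muln0 alg_polyC muln1 addr0.
  by rewrite /w scale0r.
rewrite big_partitions (bigD1 b) //= sum_w {1 2}/w eqxx scale1r add0r.
congr (polyseq (_ * _))`_n; apply: eq_bigr => a /negbTE ane.
by rewrite sum_w /w ane scaleN1r.
Qed.

(** * The matrix factorization *)

Definition toeplitz (N : nat) (p : {poly int}) : 'M[int]_N :=
  \matrix_(i, j) (p * 'X^j)`_i.

(** Dirichlet convolution by [f], as a matrix indexed by positive integers. *)
Definition dirichlet (N : nat) (f : nat -> int) : 'M[int]_N :=
  \matrix_(i, j) if (j.+1 %| i.+1)%N then f (i.+1 %/ j.+1)%N else 0.

(** The vector of coefficients of [q] is sent to that of [p q]. *)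
Lemma toeplitz_mul_coef N (p q : {poly int}) (i : 'I_N) :
  \sum_(l < N) toeplitz N p i l * q`_l = (p * q)`_i.
Proof.
have q_eq : eqX N q (\poly_(l < N) q`_l).
  by move=> l lt_lN; rewrite coef_poly lt_lN.
rewrite (eqXM (eqX_refl p) q_eq (ltn_ord i)) poly_def mulr_sumr coef_sum.
by apply: eq_bigr => l _; rewrite mxE -scalerAr coefZ mulrC.
Qed.

Lemma toeplitzM N p q : toeplitz N p *m toeplitz N q = toeplitz N (p * q).
Proof.
apply/matrixP => i j; rewrite !mxE -mulrA -toeplitz_mul_coef.
by apply: eq_bigr => l _; rewrite !mxE.
Qed.

Lemma toeplitz_eq1 N p : eqX N p 1 -> toeplitz N p = 1%:M.
Proof.
move=> p1; apply/matrixP => i j.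
rewrite !mxE (eqXM p1 (eqX_refl 'X^j) (ltn_ord i)) mul1r coefXn.
by rewrite -val_eqE.
Qed.

Lemma dirichlet_moebiusK N :
  dirichlet N moebius *m dirichlet N (fun=> 1) = 1%:M.
Proof.
apply/matrixP => i j; rewrite !mxE.
transitivity (\sum_(d <- divisors i.+1 | (j.+1 %| d)%N) moebius (i.+1 %/ d)%N);
  last by rewrite sum_moebius_interval // eqSS val_eqE.
rewrite [RHS]big_mkcond (@big_divisors_ord _ N) //= [RHS]big_mkcond.
apply: eq_bigr => l _; rewrite !mxE.
by case: ifP; case: ifP; rewrite ?mul0r ?mulr1 ?mulr0.
Qed.

(** The factor [\poly_(l < N) _] is the truncation of [X^j / (1 - X^(j+1))], the series of the
multiples of [j+1] shifted by one. *)
Lemma eqX_multiples N (j : 'I_N) :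
  eqX N ((1 - 'X^(j.+1)) * \poly_(l < N) (j.+1 %| l.+1)%N%:R) 'X^j.
Proof.
move=> i lt_iN; rewrite mulrBl mul1r coefB coefXnM !coef_poly lt_iN coefXn.
case: ltnP => [le_ij | lt_ji].
  rewrite subr0; case: (eqVneq i j) => [->|ne_ij]; first by rewrite dvdnn.
  by rewrite gtnNdvd // ltnS ltn_neqAle ne_ij.
rewrite (leq_ltn_trans (leq_subr _ _) lt_iN) -subSn // (gtn_eqF lt_ji).
by rewrite dvdn_subl ?subrr // leqW.
Qed.

(** The factor of the Euler product at [j] turns the series of multiples into
[X^j], which leaves the product of [s_coef]. *)
Lemma s_generating N (i j : 'I_N) :
  s i.+1 j.+1 = (euler N * \poly_(l < N) (j.+1 %| l.+1)%N%:R)`_i.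
Proof.
rewrite /euler (bigD1 j) //= mulrAC.
rewrite (eqXM (@eqX_multiples N j) (@eqX_refl _ _) (ltn_ord i)) coefXnM.
case: ltnP => [lt_ij | le_ji]; first by rewrite s_gt.
have lt_ji : (j < i.+1)%N by [].
rewrite (s_coef (Ordinal lt_ji)) coefXnM ltnNge lt_ji /= subSS.
apply/esym/(eqX_euler_widen (fun a => a != j) (ltn_ord i)).
by rewrite ltnS (leq_trans (leq_subr _ _)).
Qed.

Lemma smx_factor N :
  smx N = toeplitz N (euler N) *m dirichlet N (fun=> 1).
Proof.
apply/matrixP => i j; rewrite !mxE s_generating -toeplitz_mul_coef.
apply: eq_bigr => l _; rewrite coef_poly ltn_ord [dirichlet _ _ _ _]mxE.
by case: ifP.
Qed.

(* N is any size >= n, as ensured by the existence of i. *)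
Theorem theorem3p2 (n k N : nat) (i j : 'I_N)
    (k_gt0 : (1 <= k)%N) (le_kn : (k <= n)%N)
    (iE : i.+1 = n) (jE : j.+1 = k) :
  invmx (smx N) i j =
    \sum_(d <- divisors n) partition_fun (d%:Z - k%:Z) * moebius (n %/ d)%N.
Proof.
(* The candidate is the product of the inverses of the two factors of
   [smx N], in reverse order. *)
pose B := dirichlet N moebius *m toeplitz N (euler_inv N).
have BA : B *m smx N = 1%:M.
  rewrite smx_factor mulmxA -[B *m _]mulmxA toeplitzM toeplitz_eq1.
    by rewrite mulmx1 dirichlet_moebiusK.
  by move=> l lt_lN; apply: euler_invP (leqW lt_lN).
have -> : invmx (smx N) = B.
  by rewrite -[LHS]mul1mx -BA mulmxK ?smx_unit.
rewrite {BA}/B -{}iE -{}jE (@big_divisors_ord _ N) ?ltn_ord // mxE [RHS]big_mkcond.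
apply: eq_bigr => l _; rewrite [dirichlet _ _ _ _]mxE mxE.
case: ifP => _; rewrite ?mul0r // mulrC; congr (_ * _).
rewrite coefMXn; case: ltnP => [lt_lj | le_jl].
  (* Here [d < k], where the partition function vanishes by convention. *)
  suff -> : l.+1%:Z - j.+1%:Z = Negz (j - l).-1 by [].
  by rewrite NegzE prednK ?subn_gt0 // -subSS -subzn ?opprB // ltnW.
rewrite subzn // subSS /= (@nb_partitions_coef _ N) //.
by rewrite (leq_trans (leq_subr _ _)) // ltnW.
Qed.
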